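(* In the D-CPPG, if $(L,T)$ is a feasible pair with $T>1$, then $$(T-1)\,f_{LB-D}\Big(\frac{L}{T-1}\Big)\ \ge\ N-(2k^2+2k+1).$$ Moreover, the boundary of this inequality, $(T-1)f_{LB-D}\big(\frac{L}{T-1}\big)=N-(2k^2+2k+1)$, is a piecewise-linear convex function connecting $$\Big(\frac{N^{**}}{f_{LB-D}(1)},\frac{N^{**}}{f_{LB-D}(1)}\Big)\to\Big(\frac{2N^{**}}{f_{LB-D}(2)},\frac{N^{**}}{f_{LB-D}(2)}\Big)\to\cdots\to\Big(\frac{(2k+1)N^{**}}{f_{LB-D}(2k+1)},\frac{N^{**}}{f_{LB-D}(2k+1)}\Big)\to\Big(\infty,\frac{N^{**}}{f_{LB-D}(2k+1)}\Big),$$ where $N^{**}=N-(2k^2+2k+1)$.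
   Context: Let $m\ge n>0$ be integers, $N=mn$, $D=\{(x,y)\in\mathbb{R}^2: 0\le x\le n,\ 0\le y\le m\}$ and $D_{int}=D\cap\mathbb{Z}^2$. The unit grid is the graph on $D_{int}$ in which points at distance 1 are joined by an edge of length 1. Distances are measured in the $\ell_1$ norm. D-CPPG (discrete covering path problem on a grid), with coverage radius $k$ a positive integer: one selects a set of stops $V_1\subseteq D_{int}$ such that every point of $D_{int}$ is within distance $k$ of some stop, and a path in the grid connecting the stops (a covering path). The path length is the total length of its edges and the stop count is the number of stops. A pair $(L,T)$ is feasible if there is a covering path with at most $T$ stops and path length at most $L$. The function $f_{LB-D}$ is the piecewise-linear function connecting $(1,f_{LB-D}(1))\to(2,f_{LB-D}(2))\to\cdots\to(2k+1,f_{LB-D}(2k+1))\to(\infty,f_{LB-D}(2k+1))$, whose values at integers are $f_{LB-D}(d)=d\big(2k+1-\frac d2\big)+\frac12$ if $d\in\{1,\dots,2k\}$ is odd, $f_{LB-D}(d)=d\big(2k+1-\frac d2\big)$ if $d\in\{1,\dots,2k\}$ is even, and $f_{LB-D}(2k+1)=2k^2+2k+1$. Thus $f_{LB-D}(d)=(t+1-d)f_{LB-D}(t)+(d-t)f_{LB-D}(t+1)$ for $d\in(t,t+1)$ with $t\in\{1,\dots,2k\}$, and $f_{LB-D}(d)=2k^2+2k+1$ for $d\ge 2k+1$.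
   Formalization: The boundary part assumes N** > 0 (otherwise no point with T > 1 lies on the boundary), and the listed breakpoints are read in the coordinates (L, T−1), since they do not satisfy the equation as points (L, T). *)

(* Defs.v *)
From HB Require Import structures.
From mathcomp Require Import all_boot all_order all_algebra.
From mathcomp Require Import all_classical all_reals all_analysis.

Set Implicit Arguments.
Unset Strict Implicit.
Unset Printing Implicit Defensive.

Import Order.TTheory GRing.Theory Num.Theory.
Local Open Scope ring_scope.

(* D_int, for D = [0, n] x [0, m] *)
Definition grid (m n : nat) : finType := ('I_n.+1 * 'I_m.+1)%type.

Definition l1dist (m n : nat) (p q : grid m n) : nat :=
  (`|(p.1 : nat)%:Z - (q.1 : nat)%:Z| + `|(p.2 : nat)%:Z - (q.2 : nat)%:Z|)%N.

Definition grid_adj (m n : nat) : rel (grid m n) :=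
  fun p q => l1dist p q == 1%N.

Definition covers (m n k : nat) (V : {set grid m n}) : Prop :=
  forall p : grid m n, exists2 v, v \in V & (l1dist p v <= k)%N.

(* The path visits the vertices x :: s in this order; it may revisit vertices
   and pass through grid points that are not stops.  Edges have length 1, so
   its length is size s. *)
Definition covering_path (m n k : nat) (V : {set grid m n})
    (x : grid m n) (s : seq (grid m n)) : Prop :=
  [/\ covers k V, path (@grid_adj m n) x s & {subset V <= x :: s}].

Definition feasible (R : realType) (m n k : nat) (L T : R) : Prop :=
  exists (V : {set grid m n}) (x : grid m n) (s : seq (grid m n)),
    [/\ covering_path k V x s, #|V|%:R <= T & (size s)%:R <= L].

Definition fLBD_int (R : realType) (k t : nat) : R :=
  if (t <= 2 * k)%N then
    t%:R * ((2 * k + 1)%:R - t%:R / 2) + (if odd t then 1 / 2 else 0)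
  else (2 * k ^ 2 + 2 * k + 1)%:R.

(* Linear interpolation of fLBD_int between consecutive naturals; beyond
   2k + 1 it is constant.  The function is only specified on [1, +oo); below 1
   the same formula, with fLBD_int k 0 = 0, gives the line (2k + 1) d. *)
Definition fLBD (R : realType) (k : nat) (d : R) : R :=
  let t := Num.truncn d in
  (t%:R + 1 - d) * fLBD_int R k t + (d - t%:R) * fLBD_int R k t.+1.

(* N** : N = mn minus the number of lattice points in an l1 ball of radius k *)
Definition Nss (R : realType) (m n k : nat) : R :=
  (m * n)%:R - (2 * k ^ 2 + 2 * k + 1)%:R.

(* g, on [x 1, +oo), is the piecewise-linear function connecting
   (x 1, y 1) -> (x 2, y 2) -> ... -> (x K, y K) -> (oo, y K). *)
Definition pl_connects (R : realType) (K : nat) (x y : nat -> R)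
    (g : R -> R) : Prop :=
  [/\ forall j, (1 <= j < K)%N -> x j < x j.+1,
      forall j (a : R), (1 <= j < K)%N -> 0 <= a <= 1 ->
        g ((1 - a) * x j + a * x j.+1) = (1 - a) * y j + a * y j.+1
    & forall z, x K <= z -> g z = y K].

(* Main.v *)
(* Order the stops along the path and let d_1, d_2, ... be the distances between
   consecutive ones.  A stop at distance d from the previous one covers at most
   f(d) new lattice points, because two l1 balls of radius k at distance d
   share at least (2k^2 + 2k + 1) - f(d) points.  As f is concave,
   nondecreasing and vanishes at 0, the perspective (S, L) |-> S f(L / S)
   dominates the sum of the f(d_i), which gives the inequality.  The
   perspective is the minimum of the linear forms attached to the affine pieces
   of f, so its level curve is the graph of a maximum of finitely many affine
   functions of L, hence convex and piecewise linear. *)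

Require Import Defs.
From HB Require Import structures.
From mathcomp Require Import all_boot all_order all_algebra.
From mathcomp Require Import all_classical all_reals all_analysis.
From mathcomp Require Import zify ring lra.

Set Implicit Arguments.
Unset Strict Implicit.
Unset Printing Implicit Defensive.

Import Order.TTheory GRing.Theory Num.Theory.
Local Open Scope ring_scope.

(** * Half balls and intersections of l1 balls in the integer plane *)

Definition zdist (p q : int * int) : nat :=
  (`|p.1 - q.1| + `|p.2 - q.2|)%N.

(* The points z with zdist z c < n and z.1 + z.2 congruent to
   c.1 + c.2 + n + 1 mod 2.  In the coordinates x + y and x - y they form an
   n by n square. *)
Definition halfball (c : int * int) (n : nat) : seq (int * int) :=
  [seq (c.1 + i%:Z + j%:Z - n%:Z + 1, c.2 + i%:Z - j%:Z)
     | i <- iota 0 n, j <- iota 0 n].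

Lemma size_halfball c n : size (halfball c n) = (n * n)%N.
Proof. by rewrite size_allpairs size_iota. Qed.

Lemma halfball_uniq c n : uniq (halfball c n).
Proof.
apply: allpairs_uniq; rewrite ?iota_uniq// => -[i j] [i' j'] _ _ /= [e1 e2].
by congr pair; lia.
Qed.

Lemma halfball_zdist c n z : z \in halfball c n -> (zdist z c < n)%N.
Proof.
move=> /allpairsP[[i j]] /=; rewrite !mem_iota => -[ilt jlt ->].
by rewrite /zdist /=; lia.
Qed.

Definition zparity (p : int * int) : bool := odd `|(p.1 + p.2)%R|%N.

Lemma odd_abszD (a b : int) : odd `|(a + b)%R|%N = odd `|a|%N (+) odd `|b|%N.
Proof. by lia. Qed.

Lemma odd_zdist p q : odd (zdist p q) = zparity p (+) zparity q.
Proof.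
by rewrite /zdist /zparity oddD !odd_abszD !abszN addbACA.
Qed.

Lemma halfball_parity c n z : z \in halfball c n ->
  zparity z = zparity c (+) ~~ odd n.
Proof.
move=> /allpairsP[[i j]] /= [_ _ ->].
rewrite /zparity /= !odd_abszD !abszN /=.
by case: (odd i); case: (odd j); case: (odd n);
   case: (odd `|c.1|%N); case: (odd `|c.2|%N).
Qed.

Lemma mem_halfball c n z : (zdist z c < n)%N ->
  zparity z = zparity c (+) ~~ odd n -> z \in halfball c n.
Proof.
move=> lt_n par.
have {}par : odd (zdist z c) = ~~ odd n by rewrite odd_zdist par addbAC addbb.
case: z lt_n par => a b; rewrite /zdist /= => lt_n par.
apply/allpairsP.
exists (`|(a - c.1 + (b - c.2) + n%:Z - 1)%R|./2%N,
  `|(a - c.1 - (b - c.2) + n%:Z - 1)%R|./2%N); split=> /=.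
- by rewrite mem_iota; lia.
- by rewrite mem_iota; lia.
- by congr pair; lia.
Qed.

Lemma zdist_trans q p z : (zdist p z <= zdist p q + zdist q z)%N.
Proof. by rewrite /zdist; lia. Qed.

(** Points whose distance to [p] has the parity of [k] fall in the larger half ball; the others are
    closer than [k], so in the smaller one. *)
Lemma zball_sub p k z : (zdist z p <= k)%N ->
  z \in halfball p k.+1 ++ halfball p k.
Proof.
move=> le_k; rewrite mem_cat.
have dk := odd_zdist z p.
have [par|par] := eqVneq (zparity z) (zparity p (+) odd k).
  by rewrite mem_halfball//= negbK.
rewrite (@mem_halfball _ k) ?orbT//.
  rewrite ltn_neqAle le_k andbT; apply: contraNneq par => d_k.
  by move: dk; rewrite d_k => ->; case: (zparity z); case: (zparity p).
by move: par; case: (zparity z); case: (zparity p); case: (odd k).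
Qed.

Lemma zdist_midpoint p q h : (h <= zdist p q)%N ->
  exists2 c, zdist c p = h & zdist c q = (zdist p q - h)%N.
Proof.
case: p q => [a b] [a' b']; rewrite /zdist /= => le_h.
have [hx|hx] := leqP h `|a - a'|%N.
- have [la|la] := lerP a a'.
  + by exists (a + h%:Z, b) => /=; lia.
  + by exists (a - h%:Z, b) => /=; lia.
- have [lb|lb] := lerP b b'.
  + by exists (a', b + (h%:Z - `|a - a'|%N%:Z)) => /=; lia.
  + by exists (a', b - (h%:Z - `|a - a'|%N%:Z)) => /=; lia.
Qed.

(* The two half balls are centred at points that split a geodesic from p to q
   as evenly as possible; they are disjoint by parity and lie in both balls. *)
Lemma zball_inter p q k : exists I : seq (int * int),
  [/\ uniq I,
      {in I, forall z, (zdist z p <= k)%N /\ (zdist z q <= k)%N} &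
      size I = ((k.+1 - uphalf (zdist p q)) ^ 2
                + (k - (zdist p q)./2) ^ 2)%N].
Proof.
set d := zdist p q.
have [c cp cq] : exists2 c, zdist c p = d./2 & zdist c q = (d - d./2)%N.
  by apply: zdist_midpoint; rewrite -/d; lia.
have [c' cp' cq'] :
    exists2 c, zdist c p = uphalf d & zdist c q = (d - uphalf d)%N.
  by apply: zdist_midpoint; rewrite -/d; lia.
exists (halfball c (k.+1 - uphalf d) ++ halfball c' (k - d./2)); split.
- rewrite cat_uniq !halfball_uniq /= andbT; apply/hasPn => z z'.
  apply/negP => zin.
  have lt1 := halfball_zdist zin; have lt2 := halfball_zdist z'.
  have := halfball_parity zin; rewrite (halfball_parity z').
  have := odd_zdist c p; have := odd_zdist c' p; rewrite cp cp'.
  (* A common point makes both half balls nonempty, so the truncated subtractions are exact and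
     their parities computable. *)
  have [d_k d_k2] : (uphalf d <= k /\ d./2 < k)%N by lia.
  rewrite (oddB (leqW d_k)) (oddB (ltnW d_k2)) /=.
  by case: (zparity p); case: (zparity c); case: (zparity c');
     case: (odd k); case: (odd d./2); case: (odd (uphalf d)).
- move=> z; rewrite mem_cat => /orP[] /halfball_zdist lt_z;
    have := zdist_trans c z p; have := zdist_trans c z q;
    have := zdist_trans c' z p; have := zdist_trans c' z q; lia.
- by rewrite size_cat !size_halfball !mulnn.
Qed.

(* The values of f at integers: (k + 1)^2 + k^2 points in a ball, less those
   found in the intersection.  Truncated subtraction makes it constant for
   d > 2k. *)
Definition ball_gain (k d : nat) : nat :=
  ((k.+1 ^ 2 + k ^ 2) - ((k.+1 - uphalf d) ^ 2 + (k - d./2) ^ 2))%N.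

(** [S] and the common part [I] are disjoint and both lie in the ball about [q], so their sizes add
    up to at most [k.+1 ^ 2 + k ^ 2]. *)
Lemma zball_diff p q k (S : seq (int * int)) : uniq S ->
  {in S, forall z, (zdist z q <= k)%N /\ (k < zdist z p)%N} ->
  (size S <= ball_gain k (zdist p q))%N.
Proof.
move=> uS inS; have [I [uI inI sizeI]] := zball_inter p q k.
have uSI : uniq (S ++ I).
  rewrite cat_uniq uS uI andbT /=; apply/hasPn => z /inI[zp _].
  by apply/negP => /inS[_]; rewrite ltnNge zp.
have /(uniq_leq_size uSI) : {subset S ++ I <= halfball q k.+1 ++ halfball q k}.
  by move=> z; rewrite mem_cat => /orP[/inS[zq _]|/inI[_ zq]]; exact: zball_sub.
rewrite (size_cat S) (size_cat (halfball _ _)) sizeI !size_halfball !mulnn.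
move=> /leq_sub2r - /(_ ((k.+1 - uphalf (zdist p q)) ^ 2
                            + (k - (zdist p q)./2) ^ 2)%N).
by rewrite addnK.
Qed.

(** * Counting the grid points covered along a path *)

Section Grid.
Variables m n : nat.
Implicit Types (p q v x y : grid m n) (s w : seq (grid m n)).

Definition grid_int p : int * int := ((p.1 : nat)%:Z, (p.2 : nat)%:Z).

Lemma grid_int_inj : injective grid_int.
Proof.
by move=> [[a ?] [b ?]] [[a' ?] [b' ?]] [? ?]; congr pair; exact: val_inj.
Qed.

Lemma l1dist_trans q p v : (l1dist p v <= l1dist p q + l1dist q v)%N.
Proof. by rewrite /l1dist; lia. Qed.

Lemma l1distC p q : l1dist p q = l1dist q p.
Proof. by rewrite /l1dist; lia. Qed.

Lemma l1distxx p : l1dist p p = 0%N.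
Proof. by rewrite /l1dist; lia. Qed.

Lemma card_ball k x : (#|[set p | (l1dist p x <= k)%N]| <= k.+1 ^ 2 + k ^ 2)%N.
Proof.
rewrite cardE -(size_map grid_int) -!mulnn -(size_halfball (grid_int x) k.+1).
rewrite -(size_halfball (grid_int x) k) -size_cat.
apply: uniq_leq_size; first by rewrite (map_inj_uniq grid_int_inj) enum_uniq.
by move=> z /mapP[p]; rewrite mem_enum inE => ? ->; exact: zball_sub.
Qed.

Lemma card_ball_diff k x y :
  (#|[set p | (l1dist p y <= k)%N & (k < l1dist p x)%N]|
     <= ball_gain k (l1dist x y))%N.
Proof.
rewrite cardE -(size_map grid_int).
apply: (@zball_diff (grid_int x) (grid_int y)).
  by rewrite (map_inj_uniq grid_int_inj) enum_uniq.
by move=> z /mapP[p]; rewrite mem_enum inE => /andP[? ?] ->.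
Qed.

(** The induction drops the first stop: outside the ball of the next stop [y], the ball of [x] adds
    at most the gain at their distance. *)
Lemma card_cover k x w :
  (#|[set p | has (fun v => (l1dist p v <= k)%N) (x :: w)]|
     <= k.+1 ^ 2 + k ^ 2
        + sumn (map (ball_gain k) (pairmap (@l1dist m n) x w)))%N.
Proof.
elim: w x => [|y w IHw] x /=.
  rewrite addn0 (eq_card (B := [set p | (l1dist p x <= k)%N])) ?card_ball//.
  by move=> p; rewrite !inE orbF.
rewrite addnCA l1distC.
apply: leq_trans (leq_add (card_ball_diff k y x) (IHw y)).
apply: leq_trans (leq_card_setU _ _); apply/subset_leq_card/fintype.subsetP => p.
by rewrite !inE /=; case: ltnP; case: (leqP (l1dist p x)).
Qed.

(** Shortcuts by the triangle inequality; the term [l1dist x y] strengthens the induction by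
    accounting for the path before the first selected vertex. *)
Lemma subseq_length x s y w : subseq (y :: w) (x :: s) ->
  (l1dist x y + sumn (pairmap (@l1dist m n) y w)
     <= sumn (pairmap (@l1dist m n) x s))%N.
Proof.
elim: s x y w => [|z s IHs] x y w.
  by rewrite /=; have [->|] := eqVneq y x; case: w => //=; rewrite l1distxx.
rewrite [subseq _ _]/=; have [->|_] := eqVneq y x; last first.
  move=> /IHs /= H; have := l1dist_trans z x y; lia.
rewrite l1distxx; case: w => [//|u w] /IHs /= H.
have := l1dist_trans z x u; lia.
Qed.

Lemma path_length x s : path (@grid_adj m n) x s ->
  sumn (pairmap (@l1dist m n) x s) = size s.
Proof. by elim: s x => [//|y s IHs] x /= /andP[/eqP -> /IHs ->]. Qed.

Lemma feasible_card (V : {set grid m n}) k x s : covering_path k V x s ->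
  exists ds : seq nat, [/\ (size ds).+1 = #|V|, (sumn ds <= size s)%N
    & (m.+1 * n.+1 <= k.+1 ^ 2 + k ^ 2 + sumn (map (ball_gain k) ds))%N].
Proof.
move=> [cov /path_length len sub].
(* The path may revisit stops: [undup] keeps one visit of each, so [w] has [#|V|] entries and is
   still a subsequence of the path. *)
pose w := undup [seq v <- x :: s | v \in V].
have memw : w =i V.
  move=> v; rewrite mem_undup mem_filter /=.
  by apply/andP/idP => [[]//|vV]; split=> //; exact: sub.
have sizew : size w = #|V|.
  by rewrite -(eq_card memw); apply/esym/card_uniqP; exact: undup_uniq.
have subw : subseq w (x :: s).
  exact: subseq_trans (undup_subseq _) (filter_subseq _ _).
have [v vV _] := cov x; rewrite -memw in vV.
case: w vV memw sizew subw => [//|y w] _ memw sizew subw.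
exists (pairmap (@l1dist m n) y w); split.
- by rewrite size_pairmap.
- by rewrite -len; have := subseq_length subw; lia.
- apply: leq_trans (card_cover k y w).
  rewrite (eq_card (B := predT)) => [|p].
    by rewrite card_prod !card_ord mulnC.
  rewrite inE; have [u uV ?] := cov p.
  by apply/idP/hasP; exists u => //; rewrite memw.
Qed.

End Grid.

(** * Increments and affine pieces of f *)

Section LowerBoundFunction.
Variables (R : realType) (k : nat).
Implicit Types (t d : nat) (z L S : R).

(** The increments of f: 2k + 1, then 2k - 1, 2k - 1, 2k - 3, 2k - 3, ..., 1, 1, then 0 by
    truncation. *)
Definition gain_step t : nat := ((k.+1 - uphalf t).*2).-1.

Lemma gain_step_anti t d : (t <= d)%N -> (gain_step d <= gain_step t)%N.
Proof. by rewrite /gain_step; lia. Qed.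

Lemma sqr_pred (a : nat) : (a ^ 2 = a.-1 ^ 2 + (a.*2).-1)%N.
Proof. by case: a => // a /=; nia. Qed.

(** One of the two squares survives, since [uphalf t.+1] is [t./2.+1]; the other, of side
    [k.+1 - uphalf t], has its side shortened by 1. *)
Lemma ball_gainS t : ball_gain k t.+1 = (ball_gain k t + gain_step t)%N.
Proof.
pose cap d := ((k.+1 - uphalf d) ^ 2 + (k - d./2) ^ 2)%N.
have capS : cap t = (cap t.+1 + gain_step t)%N.
  rewrite /cap /gain_step [uphalf t.+1]/= [t.+1./2]/=.
  rewrite [in LHS](sqr_pred (k.+1 - uphalf t)).
  rewrite (_ : (k.+1 - uphalf t).-1 = k - uphalf t)%N; last by lia.
  rewrite (_ : k.+1 - t./2.+1 = k - t./2)%N; last by lia.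
  by lia.
have cap_le : (cap t <= k.+1 ^ 2 + k ^ 2)%N.
  by apply: leq_add; rewrite leq_sqr leq_subr.
rewrite /ball_gain -/(cap t) -/(cap t.+1); clearbody cap; move: cap_le capS.
by set F := (_ + _)%N; set c1 := cap t; set c2 := cap t.+1; clearbody F; lia.
Qed.

Lemma fLBD_int0 : fLBD_int R k 0 = 0.
Proof. by rewrite /fLBD_int /= mul0r add0r. Qed.

Lemma fLBD_intS t : fLBD_int R k t.+1 = fLBD_int R k t + (gain_step t)%:R.
Proof.
rewrite /fLBD_int /gain_step.
have [tk|tk] := ltnP t (2 * k)%N.
  rewrite (ltnW tk) /=.
  have -> : ((k.+1 - uphalf t).*2.-1 = 2 * k + 1 - (t + odd t))%N by lia.
  rewrite natrB; last by lia.
  by case: (odd t); rewrite -natr1 !natrD /=; field.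
have [->|ne] := eqVneq t (2 * k)%N.
  rewrite leqnn /=.
  have -> : ((k.+1 - uphalf (2 * k)).*2.-1 = 1)%N by lia.
  have -> : odd (2 * k) = false by lia.
  by rewrite !natrD !natrM; field.
have -> : (t <= 2 * k)%N = false by lia.
have -> : ((k.+1 - uphalf t).*2.-1 = 0)%N by lia.
by rewrite addr0.
Qed.

Lemma fLBD_int_ball_gain t : fLBD_int R k t = (ball_gain k t)%:R.
Proof.
elim: t => [|t IHt]; last by rewrite fLBD_intS ball_gainS natrD IHt.
by rewrite fLBD_int0 /ball_gain !subn0 subnn.
Qed.

(** The affine piece of f on [t, t + 1], extended to a full line with value [gain_icpt t] at 0. *)
Definition gain_slope t : R := (gain_step t)%:R.
Definition gain_icpt t : R := fLBD_int R k t - t%:R * gain_slope t.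

Lemma gain_slope_ge0 t : 0 <= gain_slope t. Proof. exact: ler0n. Qed.

Lemma gain_slope_anti t d : (t <= d)%N -> gain_slope d <= gain_slope t.
Proof. by move=> td; rewrite ler_nat gain_step_anti. Qed.

Lemma fLBD_line z :
  fLBD k z = gain_icpt (Num.truncn z) + z * gain_slope (Num.truncn z).
Proof. by rewrite /fLBD fLBD_intS /gain_icpt /gain_slope; ring. Qed.

Lemma fLBD_nat t : fLBD k (t%:R : R) = fLBD_int R k t.
Proof. by rewrite fLBD_line natrK /gain_icpt; ring. Qed.

Lemma fLBD1 : fLBD k (1 : R) = (gain_step 0)%:R.
Proof. by rewrite -[1 : R]/(1%:R) fLBD_nat (fLBD_intS 0) fLBD_int0 add0r. Qed.

(** Consecutive lines cross at [t.+1] and slopes do not increase, so moving the index away from the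
    piece containing [z] never lowers the value at [z]. *)
Lemma lineS t z : gain_icpt t.+1 + z * gain_slope t.+1
  = gain_icpt t + z * gain_slope t
    + (t.+1%:R - z) * (gain_slope t - gain_slope t.+1).
Proof. by rewrite /gain_icpt fLBD_intS -/(gain_slope t) -natr1; ring. Qed.

Lemma line_le_up t d z : t%:R <= z -> (d <= t)%N ->
  gain_icpt t + z * gain_slope t <= gain_icpt d + z * gain_slope d.
Proof.
elim: t d => [|t IHt] d tz; first by rewrite leqn0 => /eqP ->.
rewrite leq_eqVlt => /predU1P[-> //|dt].
apply: le_trans (IHt d _ dt); last by apply: le_trans tz; rewrite ler_nat.
rewrite lineS gerDl mulr_le0_ge0 ?subr_le0// subr_ge0; exact: gain_slope_anti.
Qed.

Lemma line_le_down t d z : z <= t.+1%:R -> (t <= d)%N ->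
  gain_icpt t + z * gain_slope t <= gain_icpt d + z * gain_slope d.
Proof.
move=> zt /subnKC <-; elim: (d - t)%N => [|e IHe]; first by rewrite addn0.
apply: le_trans IHe _; rewrite addnS lineS lerDl mulr_ge0 ?subr_ge0//.
  by apply: le_trans zt _; rewrite ler_nat; lia.
exact: gain_slope_anti.
Qed.

Lemma fLBD_le_line t z : 0 <= z -> fLBD k z <= gain_icpt t + z * gain_slope t.
Proof.
move=> /truncn_itv/andP[z1 z2]; rewrite fLBD_line.
have [?|?] := leqP t (Num.truncn z); first exact: line_le_up.
by apply: line_le_down; [exact: ltW | exact: ltnW].
Qed.

Lemma fLBD_segment t z : t%:R <= z <= t.+1%:R ->
  fLBD k z = gain_icpt t + z * gain_slope t.
Proof.
move=> /andP[tz zt]; apply: le_anti; rewrite fLBD_le_line ?(le_trans _ tz)//=.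
rewrite fLBD_line; have [?|?] := leqP t (Num.truncn z).
  exact: line_le_down.
by apply: line_le_up => //; exact: ltnW.
Qed.

Lemma gain_icpt_ge0 t : 0 <= gain_icpt t.
Proof.
have := fLBD_le_line t (lexx (0 : R)).
by rewrite mul0r addr0 -[X in fLBD k X]/(0%:R) fLBD_nat fLBD_int0.
Qed.

Hypothesis k_gt0 : (0 < k)%N.

Lemma gain_icpt_gt0 t : (0 < t)%N -> 0 < gain_icpt t.
Proof.
move=> t0; have := @line_le_down 1 t 0 (ler0n _ _) t0.
rewrite !mul0r !addr0; apply: lt_le_trans.
rewrite /gain_icpt fLBD_intS fLBD_int0 add0r mul1r subr_gt0 ltr_nat /gain_step /=.
by lia.
Qed.

Lemma fLBD_int_gt0 t : (0 < t)%N -> 0 < fLBD_int R k t.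
Proof.
move=> /gain_icpt_gt0; rewrite /gain_icpt subr_gt0; apply: le_lt_trans.
by rewrite mulr_ge0 ?gain_slope_ge0.
Qed.

Lemma line_const t : (2 * k + 1 <= t)%N ->
  gain_icpt t = gain_icpt (2 * k + 1) /\ gain_slope t = gain_slope (2 * k + 1).
Proof.
have sl0 d : (2 * k + 1 <= d)%N -> gain_slope d = 0.
  by move=> dk; rewrite /gain_slope /gain_step (_ : _.-1 = 0%N)//; lia.
move=> tk; rewrite /gain_icpt !sl0// !mulr0 !subr0; split=> //.
rewrite /fLBD_int; have -> : (t <= 2 * k)%N = false by lia.
by have -> : (2 * k + 1 <= 2 * k)%N = false by lia.
Qed.

(** * The perspective of f and the bound for feasible pairs *)

Lemma perspectiveE (a b L S : R) : 0 < S -> S * (a + L / S * b) = S * a + L * b.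
Proof. by move=> S0; field; rewrite gt_eqF. Qed.

Lemma perspective_le t L S : 0 <= L -> 0 < S ->
  S * fLBD k (L / S) <= S * gain_icpt t + L * gain_slope t.
Proof.
move=> L0 S0; have := @fLBD_le_line t (L / S) (divr_ge0 L0 (ltW S0)).
by rewrite -(ler_pM2l S0) perspectiveE.
Qed.

Lemma perspective_line L S : 0 < S ->
  let t := Num.truncn (L / S) in
  S * fLBD k (L / S) = S * gain_icpt t + L * gain_slope t.
Proof.
by move=> S0 t; rewrite fLBD_line perspectiveE.
Qed.

(** A single line dominates every gain, which bounds the sum through the number and the total of the
    distances only, in place of Jensen's inequality. *)
Lemma sum_gain_le t (ds : seq nat) :
  (sumn (map (ball_gain k) ds))%:R
    <= (size ds)%:R * gain_icpt t + (sumn ds)%:R * gain_slope t.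
Proof.
elim: ds => [|d ds IHds] /=; first by rewrite !mul0r addr0.
rewrite !natrD -natr1.
have := fLBD_le_line t (ler0n R d).
by rewrite fLBD_nat fLBD_int_ball_gain; lra.
Qed.

Lemma feasible_bound m n L T : feasible m n k L T -> 1 < T ->
  (m * n)%:R - (2 * k ^ 2 + 2 * k + 1)%:R <= (T - 1) * fLBD k (L / (T - 1)).
Proof.
move=> [V [x [s [/feasible_card[ds [dsV dss cov]] VT sL]]]] T1.
have S0 : 0 < T - 1 by rewrite subr_gt0.
(* Line [t] is the one active at [L / (T - 1)], where it agrees with f. *)
rewrite perspective_line//; set t := Num.truncn _.
apply: (@le_trans _ _ ((size ds)%:R * gain_icpt t + (sumn ds)%:R * gain_slope t)); last first.
  apply: lerD.
    by rewrite ler_wpM2r ?gain_icpt_ge0// lerBrDr natr1 dsV.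
  rewrite ler_wpM2r ?gain_slope_ge0//; apply: le_trans sL; by rewrite ler_nat.
apply: le_trans (sum_gain_le t ds).
rewrite lerBlDl -natrD ler_nat.
apply: (@leq_trans (m.+1 * n.+1)); first by apply: leq_mul.
by apply: leq_trans cov _; rewrite leq_add2r -!mulnn; nia.
Qed.

(** * The level curve of the perspective *)

Section Boundary.
Variable N : R.
Hypothesis N_gt0 : 0 < N.

Definition vertex_x t : R := t%:R * N / fLBD_int R k t.
Definition vertex_y t : R := N / fLBD_int R k t.

Definition boundary_line t L : R := (N - L * gain_slope t) / gain_icpt t.

Definition boundary L : R :=
  \big[Num.max/0]_(i < 2 * k + 1) boundary_line i.+1 L.

Lemma vertex_y_gt0 t : (0 < t)%N -> 0 < vertex_y t.
Proof. by move=> t0; rewrite divr_gt0 ?fLBD_int_gt0. Qed.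

Lemma vertex_xE t : vertex_x t = t%:R * vertex_y t.
Proof. by rewrite /vertex_x /vertex_y mulrA. Qed.

Lemma perspective_attained L S : 0 < S -> S <= L ->
  exists i : 'I_(2 * k + 1),
    S * fLBD k (L / S) = S * gain_icpt i.+1 + L * gain_slope i.+1.
Proof.
move=> S0 SL; rewrite perspective_line//; set t := Num.truncn _.
have t1 : (0 < t)%N by rewrite truncn_gt0 ler_pdivlMr ?mul1r.
have [tk|tk] := leqP t (2 * k).
  have tk' : (t.-1 < 2 * k + 1)%N by lia.
  by exists (Ordinal tk'); rewrite /= prednK.
have tk' : (2 * k < 2 * k + 1)%N by lia.
have [-> ->] := line_const (t := t) ltac:(lia).
by exists (Ordinal tk'); rewrite /= addn1.
Qed.

Lemma boundary_line_le t L S : (0 < t)%N ->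
  (boundary_line t L <= S) = (N <= S * gain_icpt t + L * gain_slope t).
Proof. by move=> t0; rewrite ler_pdivrMr ?gain_icpt_gt0// lerBlDr. Qed.

Lemma boundary_line_ge t L S : (0 < t)%N ->
  (S <= boundary_line t L) = (S * gain_icpt t + L * gain_slope t <= N).
Proof. by move=> t0; rewrite ler_pdivlMr ?gain_icpt_gt0// lerBrDr. Qed.

(** Each form increases with [S], so their minimum equals [N] exactly when [S] is the largest of the
    individual solutions. *)
Lemma boundaryP L S : 0 < S -> S <= L ->
  S * fLBD k (L / S) = N <-> S = boundary L.
Proof.
move=> S0 SL; have L0 : 0 <= L by apply: le_trans SL; exact: ltW.
have [i Si] := perspective_attained S0 SL.
split=> [PN|SE].
  apply: le_anti; apply/andP; split.
    apply: le_trans (le_bigmax _ _ i).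
    by rewrite boundary_line_ge// -Si PN.
  apply: bigmax_le => [|j _]; first exact: ltW.
  by rewrite boundary_line_le// -PN perspective_le.
apply: le_anti; apply/andP; split; last first.
  by rewrite Si -boundary_line_le// SE; exact: le_bigmax.
have : S <= boundary L by rewrite -SE.
move=> /bigmax_geP[|[j _]]; first by rewrite leNgt S0.
rewrite boundary_line_ge//; apply: le_trans; exact: perspective_le.
Qed.

Lemma boundary_connects : pl_connects (2 * k + 1) vertex_x vertex_y boundary.
Proof.
split.
(* After clearing denominators, the claim is that line [j] has positive intercept. *)
- move=> j /andP[j0 _]; have := gain_icpt_gt0 j0; rewrite /gain_icpt => c0.
  have fj := fLBD_int_gt0 j0; have fj1 := fLBD_int_gt0 (ltn0Sn j).
  rewrite /vertex_x ltr_pdivrMr// mulrAC ltr_pdivlMr// -natr1.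
  rewrite -subr_gt0 fLBD_intS -/(gain_slope j).
  have -> : (j%:R + 1) * N * fLBD_int R k j
     - j%:R * N * (fLBD_int R k j + gain_slope j)
     = N * (fLBD_int R k j - j%:R * gain_slope j) by ring.
  exact: mulr_gt0.
- move=> j a /andP[j0 _] /andP[a0 a1].
  set S := _ + _ * vertex_y _; set L := _ + _ * vertex_x _.
  have u0 : 0 <= (1 - a) * vertex_y j.
    by apply: mulr_ge0 (ltW (vertex_y_gt0 j0)); rewrite subr_ge0.
  have v0 : 0 <= a * vertex_y j.+1.
    exact: mulr_ge0 a0 (ltW (vertex_y_gt0 (ltn0Sn j))).
  have S0 : 0 < S.
    rewrite lt_neqAle addr_ge0// andbT eq_sym /S paddr_eq0//.
    apply/negP => /andP[]; rewrite mulf_eq0 (gt_eqF (vertex_y_gt0 j0)) orbF subr_eq0.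
    move=> /eqP <-; rewrite mul1r gt_eqF//; exact: vertex_y_gt0.
  (* [L / S] is a weighted mean of j and j + 1, so piece [j] is active. *)
  have Lj : j%:R * S <= L <= j.+1%:R * S.
    rewrite /S /L !vertex_xE -natr1; move: u0 v0.
    by set u := vertex_y j; set v := vertex_y j.+1 => u0 v0; lra.
  have SL : S <= L.
    have /andP[jSL _] := Lj.
    by apply: le_trans jSL; rewrite ler_peMl ?(ltW S0)// ler1n.
  apply/esym/boundaryP => //; rewrite (@fLBD_segment j).
    rewrite perspectiveE// /S /L !vertex_xE.
    (* The form of line [j] is linear in the point and equals [N] at both vertices. *)
    have -> : ((1 - a) * vertex_y j + a * vertex_y j.+1) * gain_icpt j +
        ((1 - a) * (j%:R * vertex_y j) + a * (j.+1%:R * vertex_y j.+1)) * gain_slope j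
      = (1 - a) * (vertex_y j * fLBD_int R k j) + a * (vertex_y j.+1 * fLBD_int R k j.+1).
      by rewrite fLBD_intS -/(gain_slope j) /gain_icpt -natr1; ring.
    by rewrite !divfK ?gt_eqF ?fLBD_int_gt0//; ring.
  by rewrite ler_pdivlMr// ler_pdivrMr.
- move=> z; rewrite vertex_xE => xz; set K := (2 * k + 1)%N in xz *.
  have yK : 0 < vertex_y K by apply: vertex_y_gt0; rewrite /K addn1.
  have Kz : K%:R <= z / vertex_y K by rewrite ler_pdivlMr.
  apply/esym/boundaryP => //.
    by apply: le_trans xz; rewrite ler_peMl ?(ltW yK)// ler1n /K addn1.
  rewrite fLBD_line.
  have [|-> ->] := @line_const (Num.truncn (z / vertex_y K)).
    by rewrite truncn_ge_nat ?ltr0n//; apply: le_trans Kz.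
  rewrite -/K /gain_icpt (_ : gain_slope K = 0).
    by rewrite !mulr0 subr0 addr0 divfK// gt_eqF// fLBD_int_gt0// /K addn1.
  by rewrite /gain_slope /gain_step (_ : _.-1 = 0%N)//; lia.
Qed.

(** A maximum of affine functions of [L], the default 0 being one of them. *)
Lemma boundary_convex (D : set (convex_lmodType R^o)) :
  convex_function D (boundary : R^o -> R^o).
Proof.
move=> t u v _ _.
change (boundary (t%:num * u + (1 - t%:num) * v)
  <= t%:num * boundary u + (1 - t%:num) * boundary v).
have b0 : 0 <= t%:num by [].
have b1 : t%:num <= 1 by [].
move: (t%:num) b0 b1 => b b0 b1.
have a0 : 0 <= 1 - b by rewrite subr_ge0.
have bd0 w : 0 <= boundary w by exact: bigmax_ge_id.
apply: bigmax_le => [|i _].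
  by rewrite addr_ge0// mulr_ge0.
apply: (@le_trans _ _ (b * boundary_line i.+1 u + (1 - b) * boundary_line i.+1 v)).
  rewrite /boundary_line !mulrA -mulrDl le_eqVlt; apply/orP; left.
  by apply/eqP; congr (_ / _); ring.
by apply: lerD; apply: ler_wpM2l => //; apply: le_bigmax.
Qed.

End Boundary.
End LowerBoundFunction.

Local Open Scope classical_set_scope.

Theorem theorem7 (R : realType) (m n k : nat)
    (hn : (0 < n)%N) (hmn : (n <= m)%N) (hk : (0 < k)%N) :
  (forall L T : R, feasible m n k L T -> 1 < T ->
     (T - 1) * fLBD k (L / (T - 1)) >= (m * n)%:R - (2 * k ^ 2 + 2 * k + 1)%:R)
  /\
  (0 < Nss R m n k ->
   let x := fun j : nat => j%:R * Nss R m n k / fLBD k (j%:R : R) in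
   let y := fun j : nat => Nss R m n k / fLBD k (j%:R : R) in
   exists g : R -> R,
     [/\ pl_connects (2 * k + 1) x y g,
         convex_function ([set z : R^o | x 1%N <= z] : set (convex_lmodType R^o)) (g : R^o -> R^o)
       & forall L T : R, 1 < T -> 1 <= L / (T - 1) ->
           ((T - 1) * fLBD k (L / (T - 1)) = Nss R m n k
            <-> x 1%N <= L /\ T - 1 = g L)]).
Proof.
split=> [L T|N_gt0 x y]; first exact: feasible_bound.
exists (boundary k (Nss R m n k)); split.
- have -> : x = vertex_x k (Nss R m n k).
    by apply/funext => j; rewrite /x fLBD_nat.
  have -> : y = vertex_y k (Nss R m n k).
    by apply/funext => j; rewrite /y fLBD_nat.
  exact: boundary_connects.
- exact: boundary_convex.
- move=> L T T1; have S0 : 0 < T - 1 by rewrite subr_gt0.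
  rewrite ler_pdivlMr// mul1r => SL.
  rewrite boundaryP//; split=> [SE|[]//]; split=> //.
  have /(boundaryP hk N_gt0 S0 SL) PN := SE.
  have -> : x 1%N = Nss R m n k / (gain_step k 0)%:R.
    by rewrite /x mul1r -fLBD1.
  rewrite ler_pdivrMr -?PN; last first.
    by rewrite ltr0n /gain_step /=; lia.
  apply: le_trans (perspective_le k 0 _ S0) _.
    by apply: le_trans SL; exact: ltW.
  by rewrite /gain_icpt fLBD_int0 mul0r subr0 mulr0 add0r.
Qed.
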